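(* There are two countably compact spaces (and hence, star Menger spaces) $X$ and $Y$ whose product $X\times Y$ is not star Menger.
   Context: All spaces are assumed to be regular and $T_1$. For a family $\mathcal{U}$ of subsets of $X$ and $A\subseteq X$, $St(A,\mathcal{U})=\bigcup\{U\in\mathcal{U}:U\cap A\neq\emptyset\}$. A space $M$ is Menger if for every sequence $\{\mathcal{U}_n:n\in\omega\}$ of open covers of $M$ there are finite subcollections $\mathcal{V}_n\subseteq\mathcal{U}_n$ ($n\in\omega$) such that $\bigcup\{\mathcal{V}_n:n\in\omega\}$ is an open cover of $M$. A space $X$ is star Menger if for every open cover $\mathcal{U}$ of $X$ there is a subspace $M\subseteq X$ which is Menger and satisfies $St(M,\mathcal{U})=X$. *)

(* Defs.v *)
From mathcomp Require Import all_boot.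
From mathcomp Require Import all_classical topology.

Set Implicit Arguments.
Unset Strict Implicit.
Unset Printing Implicit Defensive.

Local Open Scope classical_set_scope.

Definition open_cover (X : topologicalType) (U : set (set X)) : Prop :=
  U `<=` open /\ \bigcup_(A in U) A = [set: X].

Definition countably_compact_space (X : topologicalType) : Prop :=
  forall U : set (set X), open_cover U -> countable U ->
    exists V : set (set X), [/\ V `<=` U, finite_set V & open_cover V].

Definition star (X : Type) (A : set X) (U : set (set X)) : set X :=
  \bigcup_(B in [set B | U B /\ B `&` A !=set0]) B.

Definition menger_space (M : topologicalType) : Prop :=
  forall U : nat -> set (set M), (forall n, open_cover (U n)) ->
    exists V : nat -> set (set M),
      (forall n, V n `<=` U n /\ finite_set (V n)) /\
      open_cover (\bigcup_n V n).

(* [set_type M] carries the initial topology for its inclusion into [X], that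
   is, the subspace topology; the library's [subspace M] is another space: it
   has carrier [X], and the points outside [M] are isolated in it. *)
Definition star_menger_space (X : topologicalType) : Prop :=
  forall U : set (set X), open_cover U ->
    exists M : set X, menger_space (set_type M) /\ star M U = [set: X].

(* Main.v *)
(* The spaces X and Y are subspaces of the Alexandroff duplicate of the space K
   of ultrafilters on nat: both contain all the isolated points (x, true), while
   the non-isolated points (x, false) are split between them according to two
   disjoint sets P and Q of ultrafilters.  No (x, x) with x non-isolated lies in
   X * Y, so the points ((x, true), (x, true)) form a clopen discrete subset of
   X * Y, which is uncountable because K is.  For the cover by these points and
   the complement of the diagonal, a subspace M with St(M, U) = X * Y contains
   them all, hence is not even Lindelof.

   X and Y are countably compact as soon as P and Q both meet the set of limit
   points of every injective sequence t of ultrafilters.  Every such t has a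
   subsequence separated by disjoint sets, along which p |-> lim_p t is
   injective, and there are at least as many nonprincipal p as sequences of
   ultrafilters.  So every set of limit points is at least as large as the family
   of all these sets (two copies of it, even), and a transfinite choice of
   distinct representatives, as for Bernstein sets, yields P and Q. *)

Require Import Defs.
From HB Require Import structures.
From mathcomp Require Import all_boot.
From mathcomp Require Import all_classical topology wochoice.

Set Implicit Arguments.
Unset Strict Implicit.
Unset Printing Implicit Defensive.

Local Open Scope classical_set_scope.

(** * Well-orders with small initial segments and distinct representatives *)

(* Such an order exists because a well-order of minimal order type has small
   segments; if [T] embeds into a segment, pull the order back from the least
   one. *)
Lemma wf_small_segments (T : Type) : exists R : T -> T -> Prop,
  [/\ well_founded R, forall x y, x <> y -> R x y \/ R y x &
      forall (x : T) (g : T -> T), injective g -> exists y, ~ R (g y) x].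
Proof.
have [lt lt_wf lt_tri] : exists2 R : T -> T -> Prop, well_founded R &
    forall x y, x <> y -> R x y \/ R y x.
  have [R Rwo] := well_ordering_principle {classic T}.
  have Ranti : {in predT &, antisymmetric R}.
    by apply: wo_chain_antisymmetric => A _; exact: Rwo.
  have minR (S : set T) : S !=set0 ->
      exists2 z, S z & forall y, S y -> R z y.
    move=> [x Sx]; have [|z [[/asboolP Sz zmin] _]] := Rwo (fun y : {classic T} => `[< S y >]).
      by exists x; apply/asboolP.
    by exists z => // y Sy; apply: zmin; apply/asboolP.
  exists (fun x y => R x y /\ x <> y).
    move=> x; apply: contrapT => nx.
    have [z nz zmin] := minR [set y | ~ Acc (fun a b => R a b /\ a <> b) y]
      (ex_intro _ x nx).
    apply: nz; constructor => y [Ryz yz]; apply: contrapT => ny; apply: yz.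
    by apply: Ranti => //; rewrite Ryz zmin.
  move=> x y xy; have [|z [] -> zmin] := minR [set v | v = x \/ v = y].
  - by exists x; left.
  - by left; split => //; apply: zmin; right.
  - by right; split => [|/esym//]; apply: zmin; left.
have [[t0 [j0 j0i j0lt]]|none] := pselect (exists t, exists2 j : T -> T,
    injective j & forall x, lt (j x) t); last first.
  exists lt; split => // x g gi; apply: contrapT => /forallNP h.
  by apply: none; exists x, g => // y; apply: contrapT.
have [t [j ji jlt] tmin] : exists2 t, (exists2 j : T -> T, injective j & forall x, lt (j x) t)
    & forall s, lt s t -> ~ exists2 j : T -> T, injective j & forall x, lt (j x) s.
  elim: (lt_wf t0) j0 j0i j0lt => t _ IH j ji jlt.
  have [[s [st [g gi glt]]]|none] := pselect (exists s, lt s t /\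
      exists2 j : T -> T, injective j & forall x, lt (j x) s).
    exact: (IH s st g gi glt).
  exists t; first by exists j.
  by move=> s st h; apply: none; exists s.
exists (fun x y => lt (j x) (j y)); split.
- move=> x; have [t' tE] : exists t', t' = j x by exists (j x).
  elim: (lt_wf t') x tE => {}t' _ IH x tE; constructor => y yx.
  by apply: (IH (j y)) => //; rewrite tE.
- by move=> x y xy; apply: lt_tri => /ji.
- move=> x g gi; apply: contrapT => /forallNP h.
  apply: (tmin (j x) (jlt x)); exists (j \o g); first exact: inj_comp.
  by move=> y; exact: contrapT (h y).
Qed.

(** Transfinite recursion: [T] injects into [L t] but not into the segment below [t], so the values
    taken before stage [t] cannot exhaust [L t]. *)
Lemma distinct_representatives (T : Type) (K : choiceType) (L : T -> set K) :
  (forall t, exists2 phi : T -> K, injective phi & forall s, L t (phi s)) ->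
  exists2 f : T -> K, injective f & forall t, L t (f t).
Proof.
move=> hL.
have [R [Rwf Rtri Rsmall]] := wf_small_segments T.
have /choice [phi phiP] t : exists g : T -> K, injective g /\ forall s, L t (g s).
  by have [g gi gL] := hL t; exists g.
pose step t (rec : forall s, R s t -> K) : K :=
  xget (phi t t) [set a | L t a /\ forall s (h : R s t), rec s h <> a].
pose f := Fix Rwf (fun _ => K) step.
have fE t : f t = step t (fun s _ => f s).
  rewrite /f Fix_eq // => s g h gh; congr step.
  by apply: functional_extensionality_dep => u; apply: funext => r; exact: gh.
have fP t : L t (f t) /\ forall s, R s t -> f s <> f t.
  rewrite [f t]fE /step; case: xgetP => [a _ //|none]; exfalso.
  have [phii phiL] := phiP t.
  (* If all values of [phi t] were taken, sending [x] to an earlier stage that took [phi t x] would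
     inject [T] into the segment below [t]. *)
  have /choice [g gP] x : exists s, R s t /\ f s = phi t x.
    apply: contrapT => /forallNP nx.
    by apply: (none (phi t x)); split => // s h fs; apply: (nx s).
  have [|y] := Rsmall t g; last by apply; case: (gP y).
  by move=> x y gxy; apply: phii; case: (gP x) (gP y) => [_ <-] [_ <-]; rewrite gxy.
exists f; last by move=> t; case: (fP t).
move=> x y fxy; apply: contrapT => /Rtri [xy|yx].
  by case: (fP y) => _ /(_ _ xy).
by case: (fP x) => _ /(_ _ yx); rewrite fxy.
Qed.

(** * Ultrafilters on [nat] and limits along an ultrafilter *)

Definition ultra := {F : set_system nat | UltraFilter F}.
HB.instance Definition _ := gen_eqMixin ultra.
HB.instance Definition _ := gen_choiceMixin ultra.

Instance ultra_ultrafilter (u : ultra) : UltraFilter (sval u) := svalP u.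

Lemma ultraC (u : ultra) A : sval u (~` A) <-> ~ sval u A.
Proof.
split => [uC uA|nA]; last by have [//|] := in_ultra_setVsetC A (svalP u).
by apply: (@filter_not_empty _ (sval u) _); rewrite -(setICr A); exact: filterI.
Qed.

Lemma ultra_separated (u v : ultra) : u <> v ->
  exists2 A, sval u A & sval v (~` A).
Proof.
move=> uv; apply: contrapT => /forall2NP h; apply: uv.
rewrite (sig_eta u) (sig_eta v); apply/eq_exist/seteqP; split => A.
  by move=> uA; have [//|/ultraC /contrapT] := h A.
move=> vA; apply: contrapT => /ultraC uA; by have [|] := h (~` A); rewrite ?setCK.
Qed.

Lemma is_ultra (F : set_system nat) : ProperFilter F ->
  (forall A, F A \/ F (~` A)) -> UltraFilter F.
Proof.
move=> FF FC; split => // G GF FG; apply/seteqP; split => // A GA.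
have [//|/FG GC] := FC A.
by exfalso; apply: (@filter_not_empty _ G _); rewrite -(setICr A); exact: filterI.
Qed.

(** These sets form the limit of [t] along [p] in the Stone-Cech compactification of [nat]. *)
Definition ultra_lim_sets (p : ultra) (t : nat -> ultra) : set_system nat :=
  [set A | sval p [set n | sval (t n) A]].

Lemma ultra_lim_ultra p t : UltraFilter (ultra_lim_sets p t).
Proof.
apply: is_ultra.
  apply: Build_ProperFilter_ex; last split.
  - move=> A pA; have [n nA] := @filter_ex _ (sval p) _ _ pA.
    exact: (@filter_ex _ (sval (t n)) _ _ nA).
  - apply: (@filterS _ (sval p) _ setT) => [n _|]; exact: filterT.
  - move=> A B; apply: (@filterS2 _ (sval p)) => n; exact: filterI.
  - move=> A B AB; apply: (@filterS _ (sval p)) => n; exact: filterS.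
move=> A; have [pA|pA] := in_ultra_setVsetC [set n | sval (t n) A] (svalP p).
  by left.
by right; apply: (@filterS _ (sval p)) pA => n /= /ultraC.
Qed.

Definition ultra_lim p t : ultra := exist _ _ (ultra_lim_ultra p t).

Definition principal (n : nat) : ultra := exist _ _ (principal_filter_ultra n).

(** For an ultrafilter, containing every tail means being none of the [principal n]. *)
Definition nonprincipal (p : ultra) := forall m, sval p [set k | m <= k].

(** * Coding a sequence of ultrafilters by a single one *)

Definition digit (k i : nat) := nth 0 (CodeSeq.decode k) i.

Lemma digit_pattern m (a : nat -> nat) :
  exists2 k, m <= k & forall i, i < m -> digit k i = a i.
Proof.
(* A code exceeds every entry of its sequence, so the extra last entry [m] pushes it above [m]
   without changing the first [m] digits. *)
exists (CodeSeq.code (rcons (mkseq a m) m)).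
  have /allP/(_ m) := CodeSeq.ltn_code (rcons (mkseq a m) m).
  by rewrite mem_rcons in_cons eqxx => /(_ isT)/ltnW.
move=> i im; rewrite /digit CodeSeq.codeK nth_rcons size_mkseq im.
by rewrite nth_mkseq.
Qed.

(** This is the image of [u] under the map [digit ^~ i]. *)
Definition decode_ultra (u : ultra) (i : nat) : ultra :=
  ultra_lim u (fun k => principal (digit k i)).

(* The sets of [k] with [m <= k] and [digit k i \in A i] for [i < m], where
   [A i] is in [c i], are a filter base: any [u] above it decodes to [c]. *)
Lemma decode_ultra_surj (c : nat -> ultra) :
  exists2 u, nonprincipal u & decode_ultra u = c.
Proof.
pose B (mA : nat * (nat -> set nat)) :=
  [set k | mA.1 <= k /\ forall i, i < mA.1 -> mA.2 i (digit k i)].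
pose D := [set mA : nat * (nat -> set nat) | forall i, sval (c i) (mA.2 i)].
have FF : ProperFilter (filter_from D B).
  apply: filter_from_proper; first apply: filter_from_filter.
  - by exists (0, fun=> setT) => i; exact: filterT.
  - move=> [m A] [n A'] cA cA'; exists (maxn m n, fun i => A i `&` A' i).
      by move=> i; apply: filterI; [exact: cA|exact: cA'].
    move=> k [/=]; rewrite geq_max => /andP[mk nk] kA.
    by split; split => // i im; have [|] := kA i; rewrite // leq_max im ?orbT.
  - move=> [m A] cA; have /choice [a aA] i : exists n, A i n.
      exact: (filter_ex (cA i)).
    have [k mk ka] := digit_pattern m a; exists k; split => // i im.
    by rewrite ka.
have [G [GU FG]] := ultraFilterLemma FF.
exists (exist _ G GU).
  move=> m; apply: FG; exists (m, fun=> setT) => [i|k [] //]; exact: filterT.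
apply/funext => i; apply: contrapT => /ultra_separated [A GA /ultraC cA].
apply: cA; apply: contrapT => /ultraC cA.
have GC : G [set k | (~` A) (digit k i)].
  apply: FG; exists (i.+1, fun j => if j == i then ~` A else setT).
    by move=> j /=; case: eqP => [->//|_]; exact: filterT.
  by move=> k [_ /(_ i)] /=; rewrite eqxx; apply.
apply: (@filter_not_empty _ G _).
apply: (@filterS2 _ G _ _ _ _ _ GA GC) => k.
by move=> /principal_filterP.
Qed.

(** Cantor's diagonal argument: decoding is onto all sequences, but [c] differs from
    [decode_ultra u] at index [f u] for every [u]. *)
Lemma ultra_uncountable (f : ultra -> nat) : ~ injective f.
Proof.
move=> fi; pose c n := if pselect (exists2 u, f u = n & decode_ultra u n = principal 0)
  then principal 1 else principal 0.
have [u _ uc] := decode_ultra_surj c.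
have := congr1 (@^~ (f u)) uc; rewrite /c; case: (pselect _) => /= [[v /fi]|h E].
  move=> -> -> /(congr1 (fun w : ultra => sval w [set 0])) /= E.
  have : principal_filter 1 [set 0] by rewrite -E; exact/principal_filterP.
  by move=> /principal_filterP.
by apply: h; exists u.
Qed.

Lemma nonprincipal_infinite p (S : set nat) : nonprincipal p -> sval p S ->
  infinite_set S.
Proof.
move=> pn pS /finite_seqP [s sE].
apply: (@filter_not_empty _ (sval p) _).
apply: (@filterS2 _ (sval p) _ _ _ _ _ pS (pn (\max_(i <- s) i).+1)) => k.
by rewrite sE => /= ks; rewrite ltnNge (leq_bigmax_seq k).
Qed.

(** * Cluster points of injective sequences in the Stone topology *)

Definition limit_points (t : nat -> ultra) : set ultra :=
  [set x | forall A, sval x A -> infinite_set [set n | sval (t n) A]].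

(** Separate two terms with indices in [I] by a set and its complement. Infinitely many terms with
    index in [I] avoid one of these two sets; the term containing that one is chosen. *)
Lemma split_infinite (t : nat -> ultra) (I : set nat) :
  injective t -> infinite_set I ->
  exists nA : nat * set nat, [/\ I nA.1, sval (t nA.1) nA.2 &
    infinite_set (I `&` [set m | ~ sval (t m) nA.2])].
Proof.
move=> ti Iinf; have [n In] := infinite_setN0 Iinf.
have [m [Im mn]] := infinite_setN0 (infinite_setD Iinf (finite_set1 n)).
have [A nA mA] : exists2 A, sval (t n) A & sval (t m) (~` A).
  by apply: ultra_separated => /ti/esym.
have [fin|inf] := pselect (finite_set (I `&` [set k | ~ sval (t k) A])).
  exists (m, ~` A); split => //=; apply: sub_infinite_set (infinite_setD Iinf fin).
  by move=> k [Ik] /not_andP[//|]/= /contrapT kA; split => // /ultraC; exact.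
by exists (n, A).
Qed.

(** When the splitting is iterated, all later chosen terms avoid [A k]. Removing the finitely many
    earlier [A j] from [A k] therefore makes the sets disjoint and keeps them in the chosen
    terms. *)
Lemma discrete_subsequence (t : nat -> ultra) : injective t ->
  exists (sigma : nat -> nat) (B : nat -> set nat),
    trivIset setT B /\ forall k, sval (t (sigma k)) (B k).
Proof.
move=> ti; pose S := {I : set nat | infinite_set I}.
have /choice [pick_nA pickP] (I : S) := split_infinite ti (svalP I).
pose next (I : S) : S := let: And3 _ _ h := pickP I in exist (fun J : set nat => infinite_set J) _ h.
pose I k := iter k next (exist (fun J : set nat => infinite_set J) _ infinite_nat).
pose A k := (pick_nA (I k)).2; pose sigma k := (pick_nA (I k)).1.
have nextE J : sval (next J) = sval J `&` [set m | ~ sval (t m) (pick_nA J).2].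
  by rewrite /next; case: (pickP J).
have Isub j k m : j < k -> sval (I k) m -> ~ sval (t m) (A j).
  elim: k => // k IH; rewrite ltnS leq_eqVlt => /predU1P[->|jk].
    by rewrite /I iterS nextE => -[].
  by rewrite /I iterS nextE => -[+ _]; exact: IH.
pose B k := A k `&` [set i | forall j, j < k -> ~ A j i].
exists sigma, B; split => [|k].
  have BB j k i : j < k -> B j i -> ~ B k i by move=> jk [Aj _] [_ /(_ _ jk)].
  apply: ltn_trivIset => j k jk; apply/seteqP; split => // i [Bj].
  by move/(BB _ _ _ jk Bj).
have [Ik Ak _] := pickP (I k); apply: filterI => //.
suff : forall m, m <= k -> sval (t (sigma k)) [set i | forall j, j < m -> ~ A j i].
  by apply.
elim=> [_|m IH mk]; first by apply: (@filterS _ _ _ setT) => //; exact: filterT.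
have /ultraC := Isub m k _ mk Ik.
apply: (@filterS2 _ _ _ _ _ _ _ (IH (ltnW mk))) => i h Am j.
by rewrite ltnS leq_eqVlt => /predU1P[->|/h].
Qed.

(** The union of the [B j] with [j] in [C] belongs to the limit along [p] exactly when [C] belongs
    to [p], so distinct [p] have distinct limits. *)
Lemma many_limit_points (t : nat -> ultra) : injective t ->
  exists2 phi : (nat -> ultra) * bool -> ultra,
    injective phi & forall c, limit_points t (phi c).
Proof.
move=> ti; have [sigma [B [Bdisj sB]]] := discrete_subsequence ti.
(* Index 0 holds the Boolean, read as the number 0 or 1, and the sequence is shifted by one. *)
pose code (c : (nat -> ultra) * bool) n :=
  if n is m.+1 then c.1 m else principal c.2.
have /choice [p pP] c : exists p, nonprincipal p /\ decode_ultra p = code c.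
  by have [u] := decode_ultra_surj (code c); exists u.
have p_inj : injective p.
  move=> [c b] [c' b'] pE; have := (pP (c', b')).2; rewrite -pE (pP (c, b)).2 => E.
  congr pair; first by apply/funext => n; exact: (congr1 (@^~ n.+1) E).
  have := congr1 (fun f : nat -> ultra => sval (f 0) [set n | n = b' :> nat]) E.
  move=> /= bE; have : principal_filter (b : nat) [set n | n = b' :> nat].
    by rewrite bE; exact/principal_filterP.
  by move=> /principal_filterP /=; case: b b' {pE E bE} => [] [].
have Bother k C : sval (t (sigma k)) (\bigcup_(j in C) B j) -> C k.
  move=> tC; apply: contrapT => nCk.
  apply: (@filter_not_empty _ (sval (t (sigma k))) _).
  apply: (@filterS2 _ (sval (t (sigma k))) _ _ _ _ _ tC (sB k)) => i [j Cj Bj] Bk.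
  by apply: nCk; rewrite -(Bdisj j k) //; exists i.
exists (fun c => ultra_lim (p c) (t \o sigma)).
  move=> c c' E; apply: p_inj; apply: contrapT => /ultra_separated [C cC /ultraC c'C].
  have : sval (ultra_lim (p c) (t \o sigma)) (\bigcup_(j in C) B j).
    apply: (@filterS _ (sval (p c)) _ _ _ _ cC) => k Ck.
    by apply: (@filterS _ (sval (t (sigma k))) _ _ _ _ (sB k)) => i Bi; exists k.
  rewrite E => h; apply: c'C; apply: (@filterS _ (sval (p c')) _ _ _ _ h) => k.
  exact: Bother.
(* The indices [k] with [A] in [t (sigma k)] form a member of a nonprincipal ultrafilter, and
   [sigma] is injective because the sets [B k] are disjoint and nonempty. *)
move=> c A cA fin; have := nonprincipal_infinite (pP c).1 cA; apply.
have : finite_set (sigma @^-1` [set n | sval (t n) A]); last exact.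
apply: finite_preimage fin => j k _ _ jk; apply: (Bdisj j k) => //.
by apply: (@filter_ex _ (sval (t (sigma j)))); apply: filterI; rewrite // jk.
Qed.

(** The Boolean index gives each injective sequence two distinct representatives, one for [P] and
    one for [Q]. *)
Lemma disjoint_limit_sets : exists P Q : set ultra,
  [/\ P `&` Q = set0,
      forall t, injective t -> (P `&` limit_points t) !=set0 &
      forall t, injective t -> (Q `&` limit_points t) !=set0].
Proof.
pose T := {t : nat -> ultra | injective t}.
have [|f fi fL] :=
    @distinct_representatives (T * bool) ultra (fun tb => limit_points (sval tb.1)).
  move=> [t b]; have [phi phii phiL] := many_limit_points (svalP t).
  exists (fun sb => phi (sval sb.1, sb.2)); last by move=> s; exact: phiL.
  move=> [s c] [s' c'] /phii [ss ->]; congr pair.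
  by rewrite (sig_eta s) (sig_eta s'); exact: eq_exist.
pose P b := [set f (t, b) | t in [set: T]].
have Pt b t : injective t -> (P b `&` limit_points t) !=set0.
  move=> ti; exists (f (exist _ t ti, b)); split; last exact: fL.
  by exists (exist _ t ti).
exists (P true), (P false); split; try exact: Pt.
by apply/seteqP; split => // x [[s _ <-] [s' _ /fi]].
Qed.

(** * Countably compact spaces are star Menger *)

Lemma history_choice (T : Type) (R : seq T -> T -> Prop) :
  (forall l, exists z, R l z) -> exists s : nat -> T, forall n, R (mkseq s n) (s n).
Proof.
move=> /choice [g gR]; pose h n := iter n (fun l => rcons l (g l)) [::].
exists (g \o h) => n; suff -> : mkseq (g \o h) n = h n by exact: gR.
by elim: n => // n IH; rewrite mkseqS IH.
Qed.

Lemma finite_menger (M : topologicalType) : finite_set [set: M] -> menger_space M.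
Proof.
move=> Mfin U Ucov.
have /choice [C CP] (nx : nat * M) : exists A, U nx.1 A /\ A nx.2.
  by have [_ /seteqP[_ /(_ nx.2 I) [A]]] := Ucov nx.1; exists A.
exists (fun n => [set C (n, x) | x in [set: M]]); split.
  by move=> n; split; [move=> _ [x _ <-]; exact: (CP (n, x)).1|exact: finite_image].
split; first by move=> _ [n _ [x _ <-]]; apply: (Ucov n).1; exact: (CP (n, x)).1.
apply/seteqP; split => // x _.
exists (C (0, x)); last exact: (CP (0, x)).2.
by exists 0 => //; exists x.
Qed.

(** Otherwise points [s n] can be chosen successively outside the star of the preceding ones, and
    they produce a countable open cover without a finite subcover. *)
Lemma countably_compact_star_finite (X : topologicalType) (U : set (set X)) :
  countably_compact_space X -> open_cover U ->
  exists l : seq X, star [set` l] U = [set: X].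
Proof.
move=> Xcc [Uo Ucov]; apply: contrapT => /forallNP nl.
have [s sP] : exists s : nat -> X, forall n, ~ star [set` mkseq s n] U (s n).
  apply: (history_choice (R := fun l z => ~ star [set` l] U z)) => l.
  apply: contrapT => /forallNP h; apply: (nl l); apply/seteqP; split => // z _.
  exact: contrapT (h z).
have sU A i j : U A -> i < j -> A (s i) -> ~ A (s j).
  move=> UA ij Ai Aj; apply: (sP j); exists A => //; split => //; exists (s i).
  by split => //=; apply/mapP; exists i; rewrite ?mem_iota.
(* No member of [U] contains two terms of [s], so the open sets [W k] below
   increase to the whole space. *)
pose W k := \bigcup_(A in [set A | U A /\ forall i, k <= i -> ~ A (s i)]) A.
have Wmono i j : i <= j -> W i `<=` W j.
  move=> ij x [A [UA As] Ax]; exists A => //; split => // k jk.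
  exact: As (leq_trans ij jk).
have [||V [VW Vfin [_ Vcov]]] := Xcc (range W).
- split; first by move=> _ [k _ <-]; apply: bigcup_open => A [/Uo].
  apply/seteqP; split => // x _; have [A UA Ax] : (\bigcup_(A in U) A) x by rewrite Ucov.
  have [[i Ai]|none] := pselect (exists i, A (s i)).
    by exists (W i.+1); [exists i.+1|exists A => //; split => // j /(sU A i j); exact].
  by exists (W 0); [exists 0|exists A => //; split => // j _ Aj; apply: none; exists j].
- exact: sub_countable (card_image_le _ _) (countableP _).
(* By monotonicity a finite subfamily lies below a single [W m], which misses [s m]. *)
have [m mP] : exists m, forall A, V A -> A `<=` W m.
  have /finite_seqP [r rE] := Vfin; have {}VW : {in r, forall A, exists k, A = W k}.
    by move=> A Ar; have [|k _ <-] := VW A; [rewrite rE|exists k].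
  rewrite rE; elim: r VW {rE} => [|A r IH] rW; first by exists 0.
  have [k Ak] := rW A (mem_head _ _).
  have [|m mP] := IH; first by move=> B Br; apply: rW; rewrite in_cons Br orbT.
  exists (maxn k m) => B /=; rewrite in_cons => /orP[/eqP->|Br].
    by rewrite Ak; apply: Wmono; exact: leq_maxl.
  by apply: (subset_trans (mP B Br)); apply: Wmono; exact: leq_maxr.
have [A VA Asm] : (\bigcup_(A in V) A) (s m) by rewrite Vcov.
by have [B [_ /(_ m (leqnn m))]] := mP A VA _ Asm.
Qed.

Lemma countably_compact_star_menger (X : topologicalType) :
  countably_compact_space X -> star_menger_space X.
Proof.
move=> Xcc U Ucov; have [l lU] := countably_compact_star_finite Xcc Ucov.
exists [set` l]; split => //; apply: finite_menger.
by rewrite (eq_finite_set (card_setT _)); exact: finite_seq.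
Qed.

(** * The Alexandroff duplicate *)

Lemma finite_setI_preimage {T U : Type} (A : set T) (B : set U) (f : T -> U) :
  {in A &, injective f} -> finite_set B -> finite_set (A `&` f @^-1` B).
Proof.
move=> fi; have {}fi : {in A `&` f @^-1` B &, injective f}.
  by move=> x y; rewrite !inE => -[Ax _] [Ay _]; apply: fi; rewrite inE.
by rewrite -(eq_finite_set (inj_card_eq fi)); apply: sub_finite_set => _ [x [_ ?] <-].
Qed.

(* The Alexandroff duplicate of the space of ultrafilters, restricted to [P] on
   its non-isolated level: the points [(x, true)] are isolated. *)
Definition duplicate (P : set ultra) := {z : ultra * bool | z.2 \/ P z.1}.

Section duplicate.
Variable P : set ultra.
Local Notation X := (duplicate P).

HB.instance Definition _ := gen_eqMixin X.
HB.instance Definition _ := gen_choiceMixin X.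

Definition ult (z : X) : ultra := (sval z).1.
Definition is_isolated (z : X) : bool := (sval z).2.
Definition isolated_pt (x : ultra) : X := exist _ (x, true) (or_introl isT).

Lemma duplicate_eq (z w : X) : ult z = ult w -> is_isolated z = is_isolated w -> z = w.
Proof.
case: z w => [[x b] zP] [[y c] wP]; rewrite /ult /is_isolated /= => xy bc.
by apply: eq_exist; rewrite xy bc.
Qed.

(** Basic clopen sets of ultrafilters are pulled back to both levels; a neighbourhood of a
    non-isolated point may omit only its isolated twin. *)
Definition duplicate_open (O : set X) := forall z, O z -> ~~ is_isolated z ->
  exists2 A, sval (ult z) A &
    forall w, sval (ult w) A -> w <> isolated_pt (ult z) -> O w.

Lemma duplicate_openT : duplicate_open setT.
Proof. by move=> z _ _; exists setT => //; exact: filterT. Qed.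

Lemma duplicate_openI : setI_closed duplicate_open.
Proof.
move=> O O' Oo Oo' z [Oz O'z] zi.
have [A zA AO] := Oo z Oz zi; have [B zB BO] := Oo' z O'z zi.
exists (A `&` B); first exact: filterI.
move=> w wAB wz; split.
  by apply: AO => //; apply: filterS wAB => ? [].
by apply: BO => //; apply: filterS wAB => ? [].
Qed.

Lemma duplicate_open_bigU (I : Type) (f : I -> set X) :
  (forall i, duplicate_open (f i)) -> duplicate_open (\bigcup_i f i).
Proof.
move=> fo z [i _ fz] zi; have [A zA Af] := fo i z fz zi.
by exists A => // w wA wz; exists i => //; exact: Af.
Qed.

HB.instance Definition _ := isOpenTopological.Build X
  duplicate_openT duplicate_openI duplicate_open_bigU.

Lemma duplicate_openE (O : set X) : open O = duplicate_open O.
Proof. by []. Qed.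

Lemma open_ult A : open [set z : X | sval (ult z) A].
Proof. by rewrite duplicate_openE => z zA _; exists A. Qed.

Lemma open_isolated x : open [set isolated_pt x].
Proof. by rewrite duplicate_openE => _ ->. Qed.

(** At a non-isolated [w], a different point over the same ultrafilter is the twin of [w], which
    neighbourhoods may omit; over another ultrafilter a separating set suffices. *)
Lemma open_neq (z : X) : open [set w | w <> z].
Proof.
rewrite duplicate_openE => w wz wi.
have [uv|/ultra_separated [A wA /ultraC zA]] := pselect (ult w = ult z).
  exists setT => [|y _]; first exact: filterT.
  move=> yw yz; apply: yw; rewrite yz; apply: duplicate_eq; rewrite ?uv //.
  apply: contrapT => zi; apply: wz; apply: duplicate_eq => //.
  by rewrite (negbTE wi); case: (is_isolated z) zi.
by exists A => // y yA _ yz; apply: zA; rewrite -yz.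
Qed.

Lemma duplicate_accessible : accessible_space X.
Proof.
move=> z w /eqP zw; exists [set y | y <> w]; split; first exact: open_neq.
  by rewrite inE.
by rewrite inE => /=; apply.
Qed.

(** The basic neighbourhoods are clopen: singletons at isolated points, and elsewhere a pulled-back
    clopen set minus one twin. *)
Lemma duplicate_regular : regular_space X.
Proof.
move=> z O zO; have [O' [O'o O'z] O'O] : exists2 B, open_nbhs z B & B `<=` O.
  by have : nbhs z O by []; rewrite nbhsE.
suff [V Vz [Vc VO]] : exists2 V, open_nbhs z V & closed V /\ V `<=` O'.
  exists V; first exact: open_nbhs_nbhs.
  by rewrite -((closure_id V).1 Vc); exact: subset_trans VO O'O.
have [zi|zi] := boolP (is_isolated z).
  have zE : z = isolated_pt (ult z) by exact: duplicate_eq.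
  exists [set z]; first by split => //; rewrite zE; exact: open_isolated.
  split; last by move=> _ ->.
  rewrite -[[set z]]setCK; apply: open_closedC; exact: open_neq.
have [A zA AO'] := O'o z O'z zi.
exists [set w | sval (ult w) A /\ w <> isolated_pt (ult z)].
  split; first by apply: openI; [exact: open_ult|exact: open_neq].
  by split => // zE; move: zi; rewrite zE.
split; last by move=> w [wA wz]; exact: AO'.
rewrite -[X in closed X]setCK; apply: open_closedC.
have -> : ~` [set w : X | sval (ult w) A /\ w <> isolated_pt (ult z)] =
    [set w | sval (ult w) (~` A)] `|` [set isolated_pt (ult z)].
  apply/seteqP; split => w /=.
    by move=> /not_andP[/ultraC|/contrapT]; [left|right].
  by move=> [/ultraC wA [//]|-> [_ //]].
by apply: openU; [exact: open_ult|exact: open_isolated].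
Qed.

(** Without a finite subcover, choose [s n] outside the members numbered at most [n] and over a new
    ultrafilter. A member around a limit point in [P] would contain [s n] for arbitrarily large
    [n]. *)
Lemma duplicate_countably_compact :
  (forall t, injective t -> (P `&` limit_points t) !=set0) ->
  countably_compact_space X.
Proof.
move=> PL U [Uo Ucov] /countable_injP [f fi]; apply: contrapT => noV.
have /choice [C CP] z : exists A, U A /\ A z.
  by have /seteqP[_ /(_ z I) [A]] := Ucov; exists A.
have [s sP] : exists s : nat -> X, forall n,
    ~ (\bigcup_(A in [set A | U A /\ f A <= n]) A) (s n) /\
    ult (s n) \notin mkseq (ult \o s) n.
  have [|s sP] := @history_choice X (fun l z =>
    ~ (\bigcup_(A in [set A | U A /\ f A <= size l]) A) z /\
    ult z \notin map ult l).
    move=> l; apply: contrapT => /forallNP h; apply: noV.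
    (* One member is added for each of the finitely many points lying over an ultrafilter already
       used. *)
    exists ([set A | U A /\ f A <= size l] `|` C @` [set z | ult z \in map ult l]).
    split.
    - move=> A [[]//|[z _ <-]]; exact: (CP z).1.
    - rewrite finite_setU; split.
        rewrite (_ : [set A | _] = U `&` f @^-1` `I_(size l).+1) //.
        by apply: finite_setI_preimage => //; exact: finite_II.
      apply: finite_image.
      rewrite (_ : mkset _ = sval @^-1` ([set` map ult l] `*` [set: bool])); last first.
        by apply/seteqP; split => [z|z []].
      apply: finite_preimage; last by apply: finite_setX => //; exact: finite_seq.
      by move=> z w _ _ zw; apply: duplicate_eq; rewrite /ult /is_isolated zw.
    - split.
        move=> A [[/Uo]//|[z _ <-]]; exact: Uo (CP z).1.
      apply/seteqP; split => // z _.
      have /not_andP[/contrapT [A Al Az]|/negP/negPn zl] := h z.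
        by exists A => //; left.
      by exists (C z); [right; exists z|exact: (CP z).2].
  exists s => n; have := sP n; rewrite size_mkseq.
  by rewrite -map_comp.
have ti : injective (ult \o s).
  suff lt_neq i j : i < j -> ult (s i) <> ult (s j).
    by move=> i j ij; case: (ltngtP i j) => // /lt_neq; rewrite ?ij //=; move: ij => /= ->.
  move=> ij E; have [_ /negP] := sP j; apply; rewrite -E.
  by apply/mapP; exists i; rewrite ?mem_iota.
have [x [Px xL]] := PL _ ti.
pose z : X := exist _ (x, false) (or_intror Px).
have [A xA AC] : exists2 A, sval x A &
    forall w : X, sval (ult w) A -> w <> isolated_pt x -> C z w.
  exact: (Uo _ (CP z).1 z (CP z).2 isT).
(* The twin of [z] occurs at most once in [s], and [s n] avoids [C z] as soon as [n] is at least
   [f (C z)]. *)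
have fin : finite_set ([set n | s n = isolated_pt x] `|` `I_(f (C z))).
  rewrite finite_setU; split; last exact: finite_II.
  have [[k sk]|none] := pselect (exists k, s k = isolated_pt x).
    apply: (sub_finite_set _ (finite_set1 k)) => n /= sn.
    by apply: ti; rewrite /= sn sk.
  by rewrite (_ : mkset _ = set0) //; apply/seteqP; split => // n sn; apply: none; exists n.
have [n [nA /not_orP [sn fn]]] := infinite_setN0 (infinite_setD (xL A xA) fin).
have [+ _] := sP n; apply; exists (C z); last exact: AC.
by split; [exact: (CP z).1|rewrite leqNgt; exact/negP].
Qed.

End duplicate.

(** * The product is not star Menger *)

Lemma open_prodP (X Y : topologicalType) (W : set (X * Y)) :
  (forall a b, W (a, b) -> exists A B,
    [/\ open A, open B, A a /\ B b & A `*` B `<=` W]) -> open W.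
Proof.
move=> WP; rewrite openE => -[a b] /WP [A [B [Ao Bo [Aa Bb] ABW]]].
by exists (A, B) => //=; split; exact: open_nbhs_nbhs.
Qed.

Lemma product_not_star_menger (P Q : set ultra) : P `&` Q = set0 ->
  ~ star_menger_space (duplicate P * duplicate Q)%type.
Proof.
move=> PQ0; pose d x : duplicate P * duplicate Q := (isolated_pt P x, isolated_pt Q x).
have dx_open x : open [set d x].
  apply: open_prodP => _ _ [-> ->].
  exists [set isolated_pt P x], [set isolated_pt Q x].
  by split; [exact: open_isolated|exact: open_isolated| |move=> [a b] [/= -> ->]].
pose W := [set z | forall x, z <> d x].
have Wo : open W.
  apply: open_prodP => a b abW.
  have [ab|/ultra_separated [A aA /ultraC bA]] := pselect (ult a = ult b); last first.
    exists [set z | sval (ult z) A], [set z | sval (ult z) (~` A)].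
    split; [exact: open_ult|exact: open_ult|by split => //; apply/ultraC|].
    by move=> [y z] [/= yA /ultraC zA] x [yx zx]; move: yA zA; rewrite yx zx.
  have [ai|ai] := boolP (is_isolated a).
    have aE : a = isolated_pt P (ult a) by exact: duplicate_eq.
    exists [set a], [set z | z <> isolated_pt Q (ult a)].
    split; [by rewrite aE; exact: open_isolated|exact: open_neq| |].
      by split => // bE; apply: (abW (ult a)); rewrite /d -bE -aE.
    move=> [y z] [/= -> zx] x [ax zx']; apply: zx; rewrite zx'.
    by rewrite ax.
  have [bi|bi] := boolP (is_isolated b).
    have bE : b = isolated_pt Q (ult b) by exact: duplicate_eq.
    exists [set z | z <> isolated_pt P (ult b)], [set b].
    split; [exact: open_neq|by rewrite bE; exact: open_isolated| |].
      by split => // aE; apply: (abW (ult b)); rewrite /d -bE -aE.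
    move=> [y z] [/= yx ->] x [yx' bx]; apply: yx; rewrite yx'.
    by rewrite bx.
  (* Two non-isolated points over the same ultrafilter would put it in both [P] and [Q]. *)
  have Pa : P (ult a) by case: (svalP a) => //; rewrite -/(is_isolated a) (negbTE ai).
  have Qa : Q (ult a).
    by rewrite ab; case: (svalP b) => //; rewrite -/(is_isolated b) (negbTE bi).
  by have : (P `&` Q) (ult a) by []; rewrite PQ0.
pose U := W |` range (fun x => [set d x]).
have Uo : U `<=` open by move=> A [->|[x _ <-]].
have Ucov : \bigcup_(A in U) A = setT.
  apply/seteqP; split => // z _.
  have [zW|/existsNP [x /contrapT ->]] := pselect (W z); first by exists W => //; left.
  by exists [set d x] => //; right; exists x.
move=> /(_ U (conj Uo Ucov)) [M [Mmenger MU]].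
(* The only member of [U] containing [d x] is its singleton, which must therefore meet [M]. *)
have dM x : M (d x).
  have [A [[->|[y _ <-]] AM]] : star M U (d x) by rewrite MU.
    by move=> /(_ x).
  by move=> ->; have [_ [/= -> ]] := AM.
pose UM := [set (@set_val _ M) @^-1` A | A in U].
have UMcov : open_cover UM.
  split; first by move=> _ [A /Uo Ao <-]; exists A.
  apply/seteqP; split => // z _.
  have [A UA Az] : (\bigcup_(A in U) A) (set_val z) by rewrite Ucov.
  by exists (set_val @^-1` A) => //; exists A.
(* Applied to a constant sequence of covers, the Menger property yields a countable subcover. *)
have [V [VU [_ Vcov]]] := Mmenger (fun=> UM) (fun=> UMcov).
have Vcount : countable (\bigcup_n V n).
  by apply: bigcup_countable => // n _; apply: finite_set_countable; have [] := VU n.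
have /countable_injP [f fi] := Vcount.
pose dm x : set_type M := exist _ (d x) (mem_set (dM x)).
have Vd x : (\bigcup_n V n) [set dm x].
  have [A VA Ax] : (\bigcup_(A in \bigcup_n V n) A) (dm x) by rewrite Vcov.
  suff <- : A = [set dm x] by [].
  have [n _ /(VU n).1 [B [BW|[y _ By]] BA]] := VA.
    by move: Ax; rewrite -BA BW => /(_ x).
  have dxy : d x = d y by move: Ax; rewrite -BA -By.
  rewrite -BA -By -dxy.
  by apply/seteqP; split => [z /= zx|_ ->//]; exact: val_inj.
apply: (@ultra_uncountable (fun x => f [set dm x])) => x y.
move=> /fi; rewrite !inE => /(_ (Vd x) (Vd y)) xy.
have : [set dm y] (dm x) by rewrite -xy.
by move=> [].
Qed.

Theorem proposition4p7 :
  exists X Y : topologicalType,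
    [/\ regular_space X, accessible_space X,
        regular_space Y & accessible_space Y] /\
    (countably_compact_space X /\ countably_compact_space Y) /\
    (star_menger_space X /\ star_menger_space Y) /\
    ~ star_menger_space (X * Y)%type.
Proof.
have [P [Q [PQ0 PL QL]]] := disjoint_limit_sets.
have Pcc := duplicate_countably_compact PL.
have Qcc := duplicate_countably_compact QL.
exists (duplicate P), (duplicate Q); split; last split => //; last split.
- split; first [exact: duplicate_regular | exact: duplicate_accessible].
- by split; exact: countably_compact_star_menger.
- exact: product_not_star_menger.
Qed.
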